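(* Let $X,Y,Z$ be locally convex Hausdorff topological vector spaces, $K\subset Y$ a proper closed convex cone with $\operatorname{int}K\neq\emptyset$, and $S\subset Z$ a nonempty convex cone. Let $\Phi\colon X\times Z\to Y^\infty$ be a $K$-convex mapping with $0_Z\in\pi(\operatorname{dom}\Phi)$, where $\pi(x,z)=z$, and let $Z_0=\operatorname{lin}(\pi(\operatorname{dom}\Phi))$. Assume that for every $L\in\mathcal L(X,Y)$ there exist $y_L\in Y$ and a neighborhood $V_L$ of $0_Z$ such that for every $z\in V_L\cap Z_0$ there is $x\in X$ with $\Phi(x,z)-L(x)\leqq_K y_L$. Then for all $(L,y)\in\mathcal L(X,Y)\times Y$ the following two assertions are equivalent: $(\alpha)$ $\Phi(x,0_Z)-L(x)+y\notin-\operatorname{int}K$ for all $x\in X$; $(\beta)$ there exists $T\in\mathcal L_\Phi$ such that $\Phi(x,z)-L(x)-T(z)+y\notin-\operatorname{int}K$ for all $(x,z)\in X\times Z$. If, in addition, there exists $\tilde x\in X$ with $(\tilde x,0_Z)\in\operatorname{dom}\Phi$ and $\Phi(\tilde x,z)\leqq_K\Phi(\tilde x,0_Z)$ for all $z\in-S$, then for all $(L,y)\in\mathcal L(X,Y)\times Y$ assertion $(\alpha)$ is equivalent to $(\gamma)$ there exists $T\in\mathcal L_\Phi^+$ such that $\Phi(x,z)-L(x)-T(z)+y\notin-\operatorname{int}K$ for all $(x,z)\in X\times Z$.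
   Context: Ordering: $K$ proper means $K\ne Y$. $y_1\leqq_K y_2$ iff $y_1-y_2\in-K$; $y_1<_K y_2$ iff $y_1-y_2\in-\operatorname{int}K$. $Y^\infty=Y\cup\{+\infty_Y\}$, $Y^\bullet=Y\cup\{-\infty_Y,+\infty_Y\}$, where $-\infty_Y<_K y<_K+\infty_Y$ for $y\in Y$, $-\infty_Y<_K+\infty_Y$, $-(+\infty_Y)=-\infty_Y$, $y+(\pm\infty_Y)=\pm\infty_Y$ for $y\in Y$; in particular $+\infty_Y\not\leqq_K y$ for $y\in Y$ and $+\infty_Y\notin-\operatorname{int}K$. Weak supremum: for $M\subset Y^\bullet$, $\operatorname{WSup}M$ is the set of $\bar v\in Y^\bullet$ such that $\bar v\not<_K v$ for all $v\in M$ and for every $\tilde v\in Y^\bullet$ with $\tilde v<_K\bar v$ there is $v\in M$ with $\tilde v<_K v$. $\mathcal L(X,Y)$ is the space of continuous linear maps $X\to Y$. $\operatorname{dom}\Phi=\{(x,z):\Phi(x,z)\neq+\infty_Y\}$; $\Phi$ is $K$-convex if $\{(x,z,y)\in X\times Z\times Y:y\in\Phi(x,z)+K\}$ is convex. $\Phi^*(L,T)=\operatorname{WSup}\{L(x)+T(z)-\Phi(x,z):(x,z)\in X\times Z\}$ for $(L,T)\in\mathcal L(X,Y)\times\mathcal L(Z,Y)$. $\mathcal L_\Phi=\{T\in\mathcal L(Z,Y):\exists L\in\mathcal L(X,Y),\ \Phi^*(L,T)\neq\{+\infty_Y\}\}$, $\mathcal L_+(S,K)=\{T\in\mathcal L(Z,Y):T(S)\subset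 K\}$, $\mathcal L_\Phi^+=\mathcal L_\Phi\cap\mathcal L_+(S,K)$. $\operatorname{lin}$ denotes linear hull. *)

(* Defs.v *)
From HB Require Import structures.
From mathcomp Require Import all_boot all_order all_algebra.
From mathcomp Require Import all_classical all_reals all_analysis.
Set Implicit Arguments.
Unset Strict Implicit.
Unset Printing Implicit Defensive.
Import Order.TTheory GRing.Theory Num.Theory.

Local Open Scope classical_set_scope.
Local Open Scope ring_scope.

(* The two-point extension of Y by -oo and +oo is the library type [\bar Y],
   with its [adde] and [oppe]: these need only an additive group, and the
   order that the library puts on [\bar R] for ordered R plays no role.  Below
   every sum has at least one finite summand, so that (+oo) + (-oo) never
   occurs.  The one-point extension by +oo is the part of [\bar Y] where the
   value is not -oo. *)

Section Ordering.
Context {R : realType} {Y : tvsType R}.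
Implicit Types (K : set Y) (a b : \bar Y).

Definition leK K a b : Prop :=
  match a, b with
  | u%:E, v%:E => (-%R @` K) (u - v)
  | -oo%E, _ => True
  | _, +oo%E => True
  | _, _ => False
  end.

Definition ltK K a b : Prop :=
  match a, b with
  | u%:E, v%:E => (-%R @` K°) (u - v)
  | -oo%E, -oo%E => False
  | -oo%E, _ => True
  | _%:E, +oo%E => True
  | _, _ => False
  end.

(* - int K, as a set of points of [\bar Y] (all of them finite). *)
Definition Nint K : set (\bar Y) := EFin @` (-%R @` K°).

Definition WSup K (M : set (\bar Y)) : set (\bar Y) :=
  [set v | (forall u, M u -> ~ ltK K v u) /\
           (forall w, ltK K w v -> exists2 u, M u & ltK K w u)].

End Ordering.

Section Cones.
Context {R : realType} {E : lmodType R}.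

(* Only positive multiples are required, so 0 need not belong to a cone. *)
Definition cone (C : set E) := forall (t : R) x, 0 < t -> C x -> C (t *: x).

Definition convex_cone (C : set E) := convex_set C /\ cone C.

Definition lin (A : set E) : set E :=
  smallest (fun V : set E => GRing.submod_closed (mem V)) A.

End Cones.

Section Perturbation.
Context {R : realType} {X Y Z : tvsType R}.
Implicit Types (K : set Y) (S : set Z) (Phi : X * Z -> \bar Y).
Implicit Types (L : {linear X -> Y}) (T : {linear Z -> Y}).

Definition dom Phi : set (X * Z) := [set p | Phi p <> +oo%E].

Definition epi K Phi : set (X * Z * Y) :=
  [set p | exists2 k, K k & p.2%:E = (Phi p.1 + k%:E)%E].

Definition Kconvex K Phi := convex_set (epi K Phi).

Definition conjugate K Phi L T : set (\bar Y) :=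
  WSup K [set (L p.1 + T p.2)%:E - Phi p | p in [set: X * Z]]%E.

Definition LPhi K Phi : set {linear Z -> Y} :=
  [set T : {linear Z -> Y} | continuous T /\
    exists2 L : {linear X -> Y}, continuous L &
      conjugate K Phi L T <> [set +oo%E]].

Definition Lplus S K : set {linear Z -> Y} :=
  [set T : {linear Z -> Y} | continuous T /\ T @` S `<=` K].

Definition LPhi_plus S K Phi : set {linear Z -> Y} := LPhi K Phi `&` Lplus S K.

End Perturbation.

(* Main.v *)
Require Import Defs.
From HB Require Import structures.
From mathcomp Require Import all_boot all_order all_algebra.
From mathcomp Require Import all_classical all_reals all_analysis.
From mathcomp Require Import ring lra.
Set Implicit Arguments.
Unset Strict Implicit.
Unset Printing Implicit Defensive.
Import Order.TTheory GRing.Theory Num.Theory.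
Import numFieldNormedType.Exports.

Local Open Scope classical_set_scope.
Local Open Scope ring_scope.

(* By (alpha), the origin lies outside the convex set A of the pairs (z, w) such
   that w is in Phi(x, z) - L(x) + y + int K for some x.  The regularity
   hypothesis makes A large enough to separate it from the origin by a pair
   (f, g) of linear functionals with f continuous and g positive on int K, so
   that f(z) + g(w) >= 0 on A.  The multiplier is then the rank-one operator
   T(z) = - (f(z) / g(k0)) k0 for any k0 in int K.  Under the monotonicity
   hypothesis, (- t s, w) stays in A for some fixed w, all s in S and all t > 0,
   which forces f(s) <= 0, that is, T(s) in K. *)

Lemma linear_bundle (R : realType) (U V : lmodType R) (h : U -> V) :
  linear h -> exists g : {linear U -> V}, g =1 h.
Proof.
move=> hl; pose m := GRing.isLinear.Build R U V _ h hl.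
by pose g : {linear U -> V} := HB.pack h m; exists g.
Qed.

(** * Blunt cones and positive linear functionals *)

Section Separation.
Context {R : realType} {E : lmodType R}.
Implicit Types (P Q : set E) (e u v : E).

(** Sums and positive multiples together encode convexity; excluding 0 makes the cone disjoint from
    its opposite. *)
Definition blunt_cone P :=
  [/\ forall u v, P u -> P v -> P (u + v), cone P & ~ P 0].

(** Zorn's lemma runs over the sets whose union with [P] is a blunt cone, so that the empty chain,
    with empty union, is covered by [P] itself. *)
Lemma maximal_blunt_cone P : blunt_cone P -> exists Q,
  [/\ P `<=` Q, blunt_cone Q &
      forall Q', Q `<=` Q' -> blunt_cone Q' -> Q' `<=` Q].
Proof.
move=> bP; pose G (X : set E) := blunt_cone (P `|` X).
have [F FG Ftot|X [GX Xmax]] := @Zorn_bigcup E G.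
  have sub Y x : F Y -> (P `|` Y) x -> (P `|` \bigcup_(Z in F) Z) x.
    by move=> FY [|Yx]; [left|right; exists Y].
  have [PD PZ P0] := bP.
  split=> [u v [Pu|[A FA Au]] [Pv|[B FB Bv]]|t u t0 [Pu|[A FA Au]]|[//|]].
  - by left; exact: PD.
  - by apply: (sub B) => //; have [+ _ _] := FG B FB; apply; [left|right].
  - by apply: (sub A) => //; have [+ _ _] := FG A FA; apply; [right|left].
  - have [AB|BA] := Ftot A B FA FB.
      by apply: (sub B) => //; have [+ _ _] := FG B FB; apply; right => //; exact: AB.
    by apply: (sub A) => //; have [+ _ _] := FG A FA; apply; right => //; exact: BA.
  - by left; exact: PZ.
  - by apply: (sub A) => //; have [_ + _] := FG A FA; apply => //; right.
  - by move=> [A FA A0]; have [_ _] := FG A FA; apply; right.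
exists (P `|` X); split => // Q' PXQ' bQ'.
have PQ' : P `|` Q' = Q'.
  by apply/setUidPr => x Px; apply: PXQ'; left.
have XQ' : X `<=` Q' by move=> x Xx; apply: PXQ'; right.
apply: contrapT => nQ'; apply: (Xmax Q'); last by rewrite /G PQ'.
by split => // Q'X; apply: nQ' => x /Q'X; right.
Qed.

(* Unless [- u] is in [Q], the sums [q + t *: u] with [t >= 0] form a blunt cone,
   which maximality puts inside [Q]. *)
Lemma blunt_cone_total Q :
  blunt_cone Q -> (forall Q', Q `<=` Q' -> blunt_cone Q' -> Q' `<=` Q) ->
  forall u v, ~ Q (- u) -> Q v -> Q (v + u).
Proof.
move=> [QD QZ Q0] Qmax u v nQu Qv.
pose Q' := [set x | exists q t, [/\ Q q, 0 <= t & x = q + t *: u]].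
apply: (Qmax Q'); last by exists v, 1; rewrite scale1r.
  by move=> x Qx; exists x, 0; rewrite scale0r addr0.
split=> [_ _ [q [t [Qq t0 ->]]] [q' [t' [Qq' t'0 ->]]]
        |c _ c0 [q [t [Qq t0 ->]]]|[q [t [Qq t0]]]].
- exists (q + q'), (t + t'); rewrite addr_ge0 //; split=> //; first exact: QD.
  by rewrite scalerDl addrACA.
- exists (c *: q), (c * t); rewrite mulr_ge0 ?(ltW c0) //; split=> //.
    exact: QZ.
  by rewrite scalerDr scalerA.
- move: t0; rewrite le_eqVlt => /predU1P[<-|t0].
    by rewrite scale0r addr0 => q0; apply: Q0; rewrite q0.
  move=> /eqP; rewrite eq_sym addrC addr_eq0 => /eqP tu; apply: nQu.
  have -> : - u = t^-1 *: q.
    rewrite -[q]opprK -tu scalerN scalerA mulVf ?gt_eqF ?scale1r //.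
  by apply: QZ; rewrite ?invr_gt0.
Qed.

(* For a maximal cone [Q], each [u] determines the Dedekind cut of those [s]
   with [s *: e - u] in [Q]; the functional is the cut point. *)
Lemma blunt_cone_positive_functional P e :
  blunt_cone P -> (forall u, exists2 t : R, 0 < t & P (e + t *: u)) ->
  exists f : {linear E -> R^o}, f e = 1 /\ forall u, P u -> 0 <= f u.
Proof.
move=> /maximal_blunt_cone[Q [PQ bQ /(blunt_cone_total bQ) Qtot]] unit_e.
have [QD QZ Q0] := bQ.
have Qe : Q e by have [t _ /PQ] := unit_e 0; rewrite scaler0 addr0.
pose D u := [set s : R | Q (s *: e - u)].
have Dup u s s' : D u s -> s < s' -> D u s'.
  rewrite /D /= => Ds ss'.
  have -> : s' *: e - u = (s *: e - u) + (s' - s) *: e.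
    by rewrite addrAC -scalerDl addrCA subrr addr0.
  by apply: QD => //; apply: QZ; rewrite ?subr_gt0.
(* The gap between [s'] and [s] supplies the element of [Q] that totality asks for; at the cut point
   itself neither difference need lie in [Q]. *)
have Ddown u s s' : ~ D u s -> s' < s -> Q (u - s' *: e).
  rewrite /D /= => nDs ss'.
  have -> : u - s' *: e = (s - s') *: e + (u - s *: e).
    by rewrite scalerBl [RHS]addrC addrA subrK.
  by apply: Qtot; [rewrite opprB|apply: QZ; rewrite ?subr_gt0].
have excl u s : D u s -> ~ Q (u - s *: e).
  by move=> Ds Qs; apply: Q0; have := QD _ _ Ds Qs; rewrite addrA subrK subrr.
(* A step from [e] along [- u] yields a point of the cut; below, a step along [u] yields a lower
   bound. *)
have D0 u : D u !=set0.
  have [t t0 /PQ Qt] := unit_e (- u); exists t^-1; rewrite /D /=.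
  have -> : t^-1 *: e - u = t^-1 *: (e + t *: - u).
    by rewrite scalerDr scalerA mulVf ?gt_eqF ?scale1r.
  by apply: QZ; rewrite ?invr_gt0.
have Dlb u : has_lbound (D u).
  have [t t0 /PQ Qt] := unit_e u; exists (- t^-1) => s Ds.
  rewrite leNgt; apply/negP => st; apply: (excl u (- t^-1)).
    exact: Dup st.
  have -> : u - - t^-1 *: e = t^-1 *: (e + t *: u).
    by rewrite scaleNr opprK [LHS]addrC scalerDr scalerA mulVf ?gt_eqF ?scale1r.
  by apply: QZ; rewrite ?invr_gt0.
pose f u : R^o := inf (D u).
have fD u s : f u < s -> D u s.
  move=> fs; have [||s' Ds' s's] := @inf_adherent R (D u) (s - f u).
  - by rewrite subr_gt0.
  - by split; [exact: D0|exact: Dlb].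
  by apply: Dup Ds' _; move: s's; rewrite addrC subrK.
have fN u s : s < f u -> Q (u - s *: e).
  move=> sf; apply: (Ddown u ((s + f u) / 2)); last by lra.
  by move=> /(ge_inf (Dlb u)); rewrite -/(f u) => ?; lra.
(* Strict inequalities on both sides pin down [f u]. Additivity, homogeneity and [f e = 1] all
   follow from this; in the additive case [d] is half of the slack. *)
have funiq u r : (forall s, r < s -> D u s) ->
    (forall s, s < r -> Q (u - s *: e)) -> f u = r.
  move=> ru rl; apply/eqP; rewrite eq_le; apply/andP; split.
    rewrite leNgt; apply/negP => rf.
    have rm : r < (r + f u) / 2 by lra.
    by apply: excl (ru _ rm) _; apply: fN; lra.
  rewrite leNgt; apply/negP => rf.
  have rm : f u < (r + f u) / 2 by lra.
  by apply: excl (fD _ _ rm) _; apply: rl; lra.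
have fadd u v : f (u + v) = f u + f v.
  apply: funiq => s hs.
    pose d := (s - (f u + f v)) / 2; rewrite /D /=.
    have -> : s *: e - (u + v) = ((f u + d) *: e - u) + ((f v + d) *: e - v).
      by rewrite addrACA -opprD -scalerDl; congr (_ *: _ - _); rewrite /d; lra.
    by apply: QD; apply: fD; rewrite /d; lra.
  pose d := ((f u + f v) - s) / 2.
  have -> : u + v - s *: e = (u - (f u - d) *: e) + (v - (f v - d) *: e).
    by rewrite addrACA -opprD -scalerDl; congr (_ - _ *: _); rewrite /d; lra.
  by apply: QD; apply: fN; rewrite /d; lra.
have fpos c u : 0 < c -> f (c *: u) = c * f u.
  move=> c0; have cu s : s = c * (s / c) by rewrite mulrC divfK ?gt_eqF.
  apply: funiq => s hs; rewrite /D /= [s]cu -scalerA -scalerBr; apply: QZ => //.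
    by apply: fD; rewrite ltr_pdivlMr // mulrC.
  by apply: fN; rewrite ltr_pdivrMr // mulrC.
have f0 : f 0 = 0 by have := fadd 0 0; rewrite addr0 => ?; lra.
have fopp u : f (- u) = - f u.
  by have := fadd u (- u); rewrite subrr f0 => ?; lra.
have flin : linear f.
  move=> c u v; rewrite fadd; congr (_ + _).
  have [c0|c0|->] := ltgtP c 0; last by rewrite !scale0r f0.
    rewrite -[c]opprK scaleNr fopp fpos ?oppr_gt0 // [RHS]mulNr //.
  exact: fpos.
have [g gf] := linear_bundle flin.
exists g; rewrite gf; split=> [|u Pu].
  apply: funiq => s s1; rewrite /D /=.
    have -> : s *: e - e = (s - 1) *: e by rewrite scalerBl scale1r.
    by apply: QZ; rewrite ?subr_gt0.
  have -> : e - s *: e = (1 - s) *: e by rewrite scalerBl scale1r.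
  by apply: QZ; rewrite ?subr_gt0.
rewrite gf leNgt; apply/negP => fu; apply: (excl u 0); first exact: fD.
by rewrite scale0r subr0; exact: PQ.
Qed.

End Separation.

(** * Neighborhoods and continuous functionals *)

Section TopologicalVectorSpace.
Context {R : realType} {E : tvsType R}.
Implicit Types (U V K : set E) (x v : E).

Lemma near_ray x v U : nbhs x U -> \forall t \near (0 : R)^'+, U (x + t *: v).
Proof.
move=> xU.
have h : (fun t : R^o => x + t *: v) @ (0 : R^o) --> x + (0 : R^o) *: v.
  apply: (@continuous_comp R^o (E * E)%type E (fun t => (x, t *: v))
           (fun p => p.1 + p.2)); last exact: add_continuous.
  apply: cvg_pair; first exact: cvg_cst.
  apply: (@continuous_comp R^o (R^o * E)%type E (fun t => (t, v))
           (fun p => p.1 *: p.2)); last exact: scale_continuous.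
  by apply: (@cvg_pair _ _ _ _ (nbhs (0 : R^o))); [exact: cvg_id|exact: cvg_cst].
rewrite scale0r addr0 in h.
exact: (cvg_at_right_filter h).
Qed.

Lemma convex_nbhs0 U : nbhs 0 U ->
  exists V, [/\ nbhs 0 V, V `<=` U & convex_set V].
Proof.
have [B Bconvex [Bopen Bbasis]] := @locally_convex R E.
move=> /Bbasis[V [BV V0] VU]; exists V; split => //.
  by apply: open_nbhs_nbhs; split => //; exact: Bopen.
by apply: Bconvex; rewrite inE.
Qed.

(** Since [f] is odd, the lower bound on [V] becomes two-sided on the intersection of a small
    multiple of [V] with its reflection. *)
Lemma bounded_below_linear_continuous (f : {linear E -> R^o}) V (c : R) :
  nbhs 0 V -> (forall v, V v -> - c <= f v) -> continuous f.
Proof.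
move=> V0 fV x.
have c0 : 0 <= c by have := fV _ (nbhs_singleton V0); rewrite linear0; lra.
apply/cvgrPdist_lt => eps eps0.
(* The divisor [c + 1] is positive even when [c = 0], and it makes the final estimate strict. *)
have d0 : 0 < eps / (c + 1) by rewrite divr_gt0 //; lra.
have dc : eps / (c + 1) * c < eps.
  by rewrite mulrAC ltr_pdivrMr ?ltr_pM2l //; lra.
have W0 := nbhs0Z (lt0r_neq0 d0) V0.
have W1 := nbhs0N W0.
near=> y.
have /= : (+%R x @` ( *:%R (eps / (c + 1)) @` V)) y by near: y; exact: nbhsT.
move=> [_ [v Vv <-] yE].
have /= : (+%R x @` (-%R @` ( *:%R (eps / (c + 1)) @` V))) y
  by near: y; exact: nbhsT.
move=> [_ [_ [v' Vv' <-] <-] y'E].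
have e1 : f y = f x + eps / (c + 1) * f v by rewrite -yE linearD linearZ.
have e2 : f y = f x - eps / (c + 1) * f v' by rewrite -y'E linearD linearN linearZ.
have h1 : - (eps / (c + 1) * c) <= eps / (c + 1) * f v.
  by rewrite -mulrN ler_pM2l //; exact: fV.
have h2 : - (eps / (c + 1) * c) <= eps / (c + 1) * f v'.
  by rewrite -mulrN ler_pM2l //; exact: fV.
rewrite ltr_norml; apply/andP; split; lra.
Unshelve. all: by end_near. Qed.

End TopologicalVectorSpace.

(** * Convex sets and conic combinations *)

Section Convexity.
Context {R : realType} {E : lmodType R}.
Implicit Types (A K : set E).

Lemma convex_setP A : convex_set A <->
  forall x y (t s : R), 0 <= t -> 0 <= s -> t + s = 1 -> A x -> A y ->
    A (t *: x + s *: y).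
Proof.
split=> [cA x y t s t0 s0 ts Ax Ay|cA x y t /set_mem Ax /set_mem Ay].
  have t1 : t <= 1 by lra.
  have := cA x y (Itv01 t0 t1); rewrite !inE => /(_ Ax Ay).
  by rewrite /conv /= /unstable.onem (_ : 1 - t = s) //; lra.
by apply/mem_set; apply: cA => //; rewrite /unstable.onem ?subr_ge0 // addrC subrK.
Qed.

(** Normalize the weights by their sum. This is how sums of conic combinations get regrouped into a
    multiple of one point of [A]. *)
Lemma convex_set_conic_comb A x y (t s : R) : convex_set A -> 0 < t -> 0 < s ->
  A x -> A y -> exists2 z, A z & t *: x + s *: y = (t + s) *: z.
Proof.
move=> cA t0 s0 Ax Ay; have ts0 : 0 < t + s by rewrite addr_gt0.
exists ((t / (t + s)) *: x + (s / (t + s)) *: y).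
  have /convex_setP := cA; apply => //; rewrite ?divr_ge0 ?ltW //.
  by rewrite -mulrDl divff ?gt_eqF.
by rewrite scalerDr !scalerA ![(t + s) * _]mulrC !divfK ?gt_eqF.
Qed.

Lemma convex_coneD K x y : convex_cone K -> K x -> K y -> K (x + y).
Proof.
move=> [cK coneK] Kx Ky.
have [z Kz] := convex_set_conic_comb cK ltr01 ltr01 Kx Ky.
by rewrite !scale1r => ->; apply: coneK; rewrite ?addr_gt0.
Qed.

End Convexity.

(** * Interiors of convex cones *)

Section ConeInterior.
Context {R : realType} {Y : tvsType R}.
Implicit Types (K : set Y).

(** The translate of [K] by [y] is a neighborhood of the sum and is contained in [K]. *)
Lemma interior_coneD K x y : convex_cone K -> K° x -> K y -> K° (x + y).
Proof.
move=> cK Kx Ky; rewrite addrC; apply: filterS (nbhsB y Kx) => _ [k Kk <-].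
exact: convex_coneD.
Qed.

Lemma interior_cone K : cone K -> cone K°.
Proof.
move=> cK t x t0 Kx; apply: filterS (nbhsZ (lt0r_neq0 t0) Kx) => _ [k Kk <-].
exact: cK.
Qed.

Lemma convex_cone_interior K : convex_cone K -> convex_cone K°.
Proof.
move=> cK; have [_ coneK] := cK; split; last exact: interior_cone.
apply/convex_setW => x y /set_mem Kx /set_mem Ky t t0 t1; apply/mem_set.
apply: interior_coneD => //.
  exact: interior_cone.
apply: coneK; first by rewrite /unstable.onem subr_gt0.
exact: interior_subset.
Qed.

(** A cone has only positive multiples, so 0 is reached as the limit of [t *: k] as [t] decreases to
    0. *)
Lemma closed_cone0 K : closed K -> cone K -> K !=set0 -> K 0.
Proof.
move=> clK coneK [k Kk]; apply: contrapT => nK0.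
have : nbhs 0 (~` K) by apply: open_nbhs_nbhs; split => //; exact: closed_openC.
move=> /(near_ray k) nK.
have [t [nKt t0]] : exists t : R, ~ K (0 + t *: k) /\ 0 < t.
  apply: (@filter_ex _ (0 : R)^'+); near=> t; split; near: t => //.
  exact: nbhs_right_gt.
by apply: nKt; rewrite add0r; exact: coneK.
Unshelve. all: by end_near. Qed.

End ConeInterior.

(** If [c < 0], a [t] proportional to [- c / 2] brings the sum down to at most [c / 2]. This
    replaces passages to the limit below. *)
Lemma ge0_addr_small (R : realType) (c d : R) :
  (forall t, 0 < t -> 0 <= c + t * d) -> 0 <= c.
Proof.
move=> h; rewrite leNgt; apply/negP => c0.
have d1 : 0 < `|d| + 1 by rewrite ltr_wpDl.
have t0 : 0 < - c / 2 / (`|d| + 1) by rewrite !divr_gt0 // oppr_gt0.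
have := h _ t0.
have : - c / 2 / (`|d| + 1) * d <= - c / 2 / (`|d| + 1) * (`|d| + 1).
  by rewrite ler_pM2l //; have := ler_norm d; lra.
by rewrite divfK ?gt_eqF //; lra.
Qed.

(** * Separation by a nonvertical hyperplane *)

Section NonverticalSeparation.
Context {R : realType} {Y Z : tvsType R}.
Variables (K : set Y) (Z0 : set Z) (A : set (Z * Y)) (V : set Z) (w0 : Y).
Hypotheses (K_cone : convex_cone K) (K_int : K° !=set0).
Hypotheses (Z0_submod : GRing.submod_closed (mem Z0)).
Hypotheses (A_convex : convex_set A) (AZ0 : forall p, A p -> Z0 p.1).
Hypotheses (A0 : ~ A 0) (V0 : nbhs 0 V).
Hypothesis (AV : forall z k, V z -> Z0 z -> K° k -> A (z, w0 + k)).

(* [A] lies over [Z0] only; combining it with the full-dimensional set of the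
   [(z, w0 + k)], [z] in [W], [k] in [int K], still avoids the origin, so that
   continuity on [Z] of the first component needs no extension theorem. *)
Lemma nonvertical_separation :
  exists (f : {linear Z -> R^o}) (g : {linear Y -> R^o}),
    [/\ continuous f, forall k, K° k -> 0 < g k &
        forall p, A p -> 0 <= f p.1 + g p.2].
Proof.
have [W [W0 WV W_convex]] := convex_nbhs0 V0.
have Kint_cone := convex_cone_interior K_cone.
pose B : set (Z * Y) := [set p | W p.1 /\ K° (p.2 - w0)].
have B_convex : convex_set B.
  apply/convex_setP => p q t s t0 s0 ts [Wp Kp] [Wq Kq]; split=> /=.
    by have /convex_setP := W_convex; apply.
  have -> : t *: p.2 + s *: q.2 - w0 = t *: (p.2 - w0) + s *: (q.2 - w0).
    by rewrite !scalerBr addrACA -opprD -scalerDl ts scale1r.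
  by have [/convex_setP + _] := Kint_cone; apply.
pose P : set (Z * Y) := [set p | exists a b t s,
  [/\ A a, B b, 0 < t, 0 < s & p = t *: a + s *: b]].
have Z0Z c z : Z0 z -> Z0 (c *: z).
  move=> Z0z; have [Z00 Z0lin] := Z0_submod; apply: set_mem.
  by rewrite -[_ *: _]addr0; apply: Z0lin => //; exact: mem_set.
have P_blunt : blunt_cone P.
  split.
  - move=> _ _ [a [b [t [s [Aa Bb t0 s0 ->]]]]] [a' [b' [t' [s' [Aa' Bb' t'0 s'0 ->]]]]].
    have [a2 Aa2 ea] := convex_set_conic_comb A_convex t0 t'0 Aa Aa'.
    have [b2 Bb2 eb] := convex_set_conic_comb B_convex s0 s'0 Bb Bb'.
    exists a2, b2, (t + t'), (s + s'); split=> //; try exact: addr_gt0.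
    by rewrite addrACA ea eb.
  - move=> c _ c0 [a [b [t [s [Aa Bb t0 s0 ->]]]]].
    exists a, b, (c * t), (c * s); split=> //; try exact: mulr_gt0.
    by rewrite scalerDr !scalerA.
  (* If the combination vanishes, [b.1] is a multiple of [a.1], hence in [Z0]; then [b] lies in [A]
     by [AV], and convexity puts 0 in [A]. *)
  - move=> [a [b [t [s [Aa [Wb Kb] t0 s0 abE]]]]].
    have bE : b.1 = (- (t / s)) *: a.1.
      have /(congr1 fst)/= /eqP := abE; rewrite eq_sym addr_eq0 => /eqP taE.
      rewrite mulrC -mulrN -scalerA scaleNr taE opprK scalerA mulVf ?scale1r //.
      exact: lt0r_neq0.
    have Ab : A b.
      rewrite [b]surjective_pairing -[b.2](subrK w0) addrC; apply: AV => //.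
        exact: WV.
      by rewrite bE; apply: Z0Z; exact: AZ0.
    have [c Ac cE] := convex_set_conic_comb A_convex t0 s0 Aa Ab.
    apply: A0; have : c = 0; last by move=> <-.
    apply/eqP; move/eqP: abE; rewrite cE eq_sym scaler_eq0 => /orP[|//].
    by rewrite gt_eqF // addr_gt0.
have [k1 Kk1] := K_int.
have W00 := nbhs_singleton W0.
have [Z00 _] := Z0_submod; move/set_mem in Z00.
have Ae : A (0, w0 + k1) by apply: AV => //; exact: WV.
(* The base point is in [A], and a small step from it stays in [B]; their midpoint lies in [P] and
   is a step of half the length. *)
have P_unit u : exists2 t : R, 0 < t & P ((0, w0 + k1) + t *: u).
  have Kk1o : nbhs k1 K° by apply: open_nbhs_nbhs; split=> //; exact: open_interior.
  have [t [Wt Kt t0]] : exists t : R,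
      [/\ W (0 + t *: u.1), K° (k1 + t *: u.2) & 0 < t].
    apply: (@filter_ex _ (0 : R)^'+); near=> t; split; near: t.
    - exact: near_ray.
    - exact: near_ray.
    - exact: nbhs_right_gt.
  exists (2^-1 * t); first by rewrite mulr_gt0.
  exists (0, w0 + k1), ((0, w0 + k1) + t *: u), 2^-1, 2^-1; split=> //.
    by split=> //=; rewrite -[w0 + _ + _]addrA addrAC subrr add0r.
  rewrite scalerDr addrA -scalerDl scalerA; congr (_ + _).
  by rewrite -{1}[LHS]scale1r; congr (_ *: _); lra.
have [F [Fe FP]] := blunt_cone_positive_functional P_blunt P_unit.
have [f fE] : exists f : {linear Z -> R^o}, forall z, f z = F (z, 0).
  apply: linear_bundle => c z z'; rewrite -linearP; congr (F _).
  by congr pair; rewrite /= scaler0 addr0.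
have [g gE] : exists g : {linear Y -> R^o}, forall w, g w = F (0, w).
  apply: linear_bundle => c w w'; rewrite -linearP; congr (F _).
  by congr pair; rewrite /= scaler0 addr0.
have FE p : F p = f p.1 + g p.2.
  rewrite fE gE -linearD; congr (F _).
  by rewrite {1}[p]surjective_pairing; congr pair; rewrite /= ?addr0 ?add0r.
have pos a b t : A a -> B b -> 0 < t -> 0 <= F a + t * F b.
  move=> Aa Bb t0; rewrite -linearZ -linearD; apply: FP.
  by exists a, b, 1, t; rewrite scale1r.
have Be z : W z -> B (z, w0 + k1).
  by move=> Wz; split=> //=; rewrite addrAC subrr add0r.
(* Both weights in [P] are positive; letting one of them vanish gives the sign of [F] on [A] and on
   [B] separately. *)
have F_A p : A p -> 0 <= F p.
  by move=> Ap; apply: (@ge0_addr_small _ _ (F (0, w0 + k1))) => t /pos; apply => //; exact: Be.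
have F_B p : B p -> 0 <= F p.
  move=> Bp; apply: (@ge0_addr_small _ _ (F (0, w0 + k1))) => t t0.
  have tV0 : 0 < t^-1 by rewrite invr_gt0.
  have := pos _ _ _ Ae Bp tV0; rewrite -(pmulr_rge0 _ t0) mulrDr mulrA.
  by rewrite mulfV ?gt_eqF // mul1r addrC.
have gE1 : g (w0 + k1) = 1 by rewrite gE.
(* Dividing [k] by a small [t] makes the fixed offset [w0] negligible. *)
have g_ge0 k : K° k -> 0 <= g k.
  move=> Kk; apply: (@ge0_addr_small _ _ (g w0)) => t t0.
  have tV0 : 0 < t^-1 by rewrite invr_gt0.
  have /F_B : B (0, w0 + t^-1 *: k).
    split=> //=; rewrite addrAC subrr add0r.
    by have [_] := Kint_cone; apply.
  rewrite -gE linearD linearZ -(pmulr_rge0 _ t0) mulrDr.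
  by rewrite [t * (_ * _)]mulrA mulfV ?gt_eqF // mul1r addrC.
exists f, g; split.
(* On [W], positivity of [F] at [(z, w0 + k1)] and [g (w0 + k1) = 1] give [f z >= -1]. *)
- apply: (@bounded_below_linear_continuous _ _ _ W 1) => // z Wz.
  by have := F_B _ (Be z Wz); rewrite FE /= gE1; lra.
(* Strictness: [k] can be moved a little against [w0 + k1], where [g] is 1, without leaving the
   interior. *)
- move=> k Kk.
  have Kko : nbhs k K° by apply: open_nbhs_nbhs; split=> //; exact: open_interior.
  have [t [Kt t0]] : exists t : R, K° (k + t *: - (w0 + k1)) /\ 0 < t.
    apply: (@filter_ex _ (0 : R)^'+); near=> t; split; near: t.
    - exact: near_ray.
    - exact: nbhs_right_gt.
  have gt : g (k + t *: - (w0 + k1)) = g k - t.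
    by rewrite linearD linearZ linearN gE1; congr (_ + _); exact: mulrN1.
  by have := g_ge0 _ Kt; rewrite gt subr_ge0; exact: lt_le_trans.
- by move=> p Ap; rewrite -FE; exact: F_A.
Unshelve. all: by end_near. Qed.

End NonverticalSeparation.

Lemma lin_submod (R : realType) (E : lmodType R) (A : set E) :
  GRing.submod_closed (mem (lin A)).
Proof.
split=> [|c u v /set_mem Lu /set_mem Lv]; apply/mem_set => V VA.
  by have [[V0 _] _] := VA; exact: set_mem V0.
have [[_ Vlin] _] := VA; apply: set_mem; apply: Vlin; apply: mem_set.
  exact: Lu.
exact: Lv.
Qed.

Lemma continuous_scaler (R : realType) (Z Y : tvsType R) (f : Z -> R^o) (k : Y) :
  continuous f -> continuous (fun z => f z *: k).
Proof.
move=> cf z; apply: (@continuous_comp Z (R^o * Y)%type Y (fun z => (f z, k))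
  (fun p => p.1 *: p.2)); last exact: scale_continuous.
by apply: (@cvg_pair _ _ _ _ (nbhs (f z : R^o))); [exact: cf|exact: cvg_cst].
Qed.

(** * Multipliers for the perturbation mapping *)

Section Perturbation.
Context {R : realType} {X Y Z : tvsType R}.
Variables (K : set Y) (Phi : X * Z -> \bar Y).
Hypothesis Phi_Ny : forall p, Phi p <> -oo%E.

Lemma epiP p v :
  epi K Phi (p, v) <-> exists2 u, Phi p = u%:E & K (v - u).
Proof.
split=> [[k Kk /=]|[u Pu Kvu]].
  by case Pu : (Phi p) => [u| |] // [->]; exists u => //; rewrite addrAC subrr add0r.
by exists (v - u); rewrite //= Pu; congr EFin; rewrite addrC subrK.
Qed.

(** If +oo were a weak supremum, then, [y] being below it, some [L x + T z - Phi (x, z)] would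
    strictly exceed [y], which the hypothesis forbids. *)
Lemma conjugate_neq_pinfty (L : {linear X -> Y}) (T : {linear Z -> Y}) y :
  (forall x z, ~ Nint K (Phi (x, z) - (L x)%:E - (T z)%:E + y%:E)%E) ->
  conjugate K Phi L T <> [set +oo%E].
Proof.
move=> hT conjE; have : conjugate K Phi L T +oo%E by rewrite conjE.
move=> [_ /(_ y%:E I)[_ [[x z] _ <-]] /=]; have := hT x z.
case Pu : (Phi (x, z)) => [u| |] //=; last by case: (Phi_Ny Pu).
move=> nK [k Kk kE]; apply: nK; exists (- k); first by exists k.
rewrite kE /=; congr EFin.
by rewrite opprB opprD [LHS]addrC addrA.
Qed.

Hypotheses (K_cone : convex_cone K) (K0 : K 0) (K_int : K° !=set0).
Hypothesis Phi_convex : Kconvex K Phi.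

Lemma scalar_multiplier (L : {linear X -> Y}) (y yL : Y) (V : set Z) :
  nbhs 0 V ->
  (forall z, (V `&` lin (snd @` dom Phi)) z ->
     exists x, leK K (Phi (x, z) - (L x)%:E)%E yL%:E) ->
  (forall x, ~ Nint K (Phi (x, 0%R) - (L x)%:E + y%:E)%E) ->
  exists (f : {linear Z -> R^o}) (g : {linear Y -> R^o}),
    [/\ continuous f, forall k, K° k -> 0 < g k &
        forall x z u, Phi (x, z) = u%:E -> 0 <= f z + g (u - L x + y)].
Proof.
move=> V0 V_bound alpha.
(* Taking the epigraph instead of the values of [Phi] lets K-convexity pass to [A]; the interior
   absorbs the added element of [K]. *)
pose A : set (Z * Y) := [set p | exists x v,
  epi K Phi (x, p.1, v) /\ K° (p.2 - (v - L x + y))].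
have Kint_cone := convex_cone_interior K_cone.
have A_convex : convex_set A.
  apply/convex_setP => p q t s t0 s0 ts [x [v [pv Kp]]] [x' [v' [qv Kq]]].
  exists (t *: x + s *: x'), (t *: v + s *: v'); split=> /=.
    by have /convex_setP/(_ _ _ t s t0 s0 ts pv qv) := Phi_convex.
  have -> : t *: p.2 + s *: q.2 - (t *: v + s *: v' - L (t *: x + s *: x') + y) =
      t *: (p.2 - (v - L x + y)) + s *: (q.2 - (v' - L x' + y)).
    have -> : L (t *: x + s *: x') = t *: L x + s *: L x' by rewrite linearD !linearZ.
    rewrite !scalerBr [RHS]addrACA -opprD; congr (_ - _).
    rewrite !scalerDr !scalerN [RHS]addrACA [X in _ = X + _]addrACA -opprD.
    by rewrite -scalerDl ts scale1r.
  by have [/convex_setP + _] := Kint_cone; apply.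
have AZ0 p : A p -> lin (snd @` dom Phi) p.1.
  move=> [x [v [/epiP[u Pu _] _]]]; apply: sub_gen_smallest.
  by exists (x, p.1) => //; rewrite /dom /= Pu.
have A0 : ~ A 0.
  move=> [x [v [/epiP[u Pu Kvu] Kv]]]; apply: (alpha x); rewrite Pu.
  exists (u - L x + y) => //; exists (- (u - L x + y)); last by rewrite opprK.
  have -> : - (u - L x + y) = 0 - (v - L x + y) + (v - u).
    rewrite sub0r !opprD [RHS]addrC !addrA; congr (_ + _ - _).
    by rewrite addrAC subrr add0r.
  exact: interior_coneD.
(* The level [yL + y] is the regularity bound on [Phi - L], shifted by [y]. *)
have [//|f [g [cf g_gt0 fgA]]] :=
  @nonvertical_separation R Y Z K _ A V (yL + y) K_cone K_int
    (lin_submod _) A_convex AZ0 A0 V0.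
  move=> z k Vz Lz Kk; have [x] := V_bound z (conj Vz Lz).
  case Pu : (Phi (x, z)) => [u| |] //=; last by case: (Phi_Ny Pu).
  move=> [c Kc cE]; exists x, u; split.
    by apply/epiP; exists u; rewrite // subrr.
  have -> : yL + y + k - (u - L x + y) = k + c.
    rewrite -[c]opprK cE opprB [_ + k]addrC -addrA; congr (_ + _).
    by rewrite opprD addrACA subrr addr0.
  exact: interior_coneD.
exists f, g; split=> // x z u Pu; have [k0 Kk0] := K_int.
(* [A] lies strictly above the graph, which is reached by letting the slack [t *: k0] vanish. *)
apply: (@ge0_addr_small _ _ (g k0)) => t t0.
have /fgA : A (z, u - L x + y + t *: k0).
  exists x, u; split; first by apply/epiP; exists u; rewrite // subrr.
  rewrite /= addrAC subrr add0r.
  by have [_] := Kint_cone; apply.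
by rewrite linearD linearZ addrA.
Qed.

(** Monotonicity enters only as a premise of the last clause, so that one [T] serves both dual
    assertions. *)
Lemma vector_multiplier (S : set Z) (L : {linear X -> Y}) (y yL : Y) (V : set Z) :
  cone S -> nbhs 0 V ->
  (forall z, (V `&` lin (snd @` dom Phi)) z ->
     exists x, leK K (Phi (x, z) - (L x)%:E)%E yL%:E) ->
  (forall x, ~ Nint K (Phi (x, 0%R) - (L x)%:E + y%:E)%E) ->
  exists T : {linear Z -> Y},
    [/\ continuous T,
        forall x z, ~ Nint K (Phi (x, z) - (L x)%:E - (T z)%:E + y%:E)%E &
        (exists2 x0, dom Phi (x0, 0) &
           forall z, (-%R @` S) z -> leK K (Phi (x0, z)) (Phi (x0, 0))) ->
        T @` S `<=` K].
Proof.
move=> S_cone V0 V_bound alpha.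
have [f [g [cf g_gt0 fg]]] := scalar_multiplier V0 V_bound alpha.
have [k0 Kk0] := K_int.
have gk0 := g_gt0 _ Kk0.
have [T TE] : exists T : {linear Z -> Y}, forall z, T z = (- f z / g k0) *: k0.
  apply: linear_bundle => c z z'; rewrite linearP scalerA -scalerDl.
  by congr (_ *: _); rewrite /= /GRing.scale /=; ring.
(* Hence [fg] says that [g] is nonnegative on the values of [Phi - L - T + y], while [g] is negative
   on [- int K]. *)
have gT z : g (T z) = - f z.
  by rewrite TE linearZ /= /GRing.scale /= divfK // gt_eqF.
have g_ge0 k : K k -> 0 <= g k.
  move=> Kk; apply: (@ge0_addr_small _ _ (g k0)) => t t0.
  rewrite -linearZ -linearD ltW //; apply: g_gt0; rewrite addrC.
  by apply: interior_coneD => //; apply: interior_cone => //; case: K_cone.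
exists T; split.
- have -> : (T : Z -> Y) = (fun z => (- f z / g k0) *: k0) by apply/funext.
  apply: continuous_scaler => z; apply: cvgM; last exact: cvg_cst.
  by apply: cvgN; exact: cf.
- move=> x z; case Pu : (Phi (x, z)) => [u| |]; last by case: (Phi_Ny Pu).
    move=> [_ [k Kk <-] [kE]]; have := fg _ _ _ Pu.
    have -> : u - L x + y = T z - k by rewrite kE [in RHS]addrAC [RHS]addrC subrK.
    by rewrite linearB gT /= addrA subrr sub0r oppr_ge0 leNgt g_gt0.
  by move=> [].
- move=> [x0]; rewrite /dom /=; case P0 : (Phi (x0, 0%R)) => [u0| |] // _ mono; last by case: (Phi_Ny P0).
  move=> _ [s Ss <-]; have fs : f s <= 0.
    (* At [- s / t], monotonicity bounds [Phi] by [u0], whatever [t] is; multiplying the inequality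
       by [t] and letting [t] vanish leaves [- f s >= 0]. *)
    rewrite -oppr_ge0; apply: (@ge0_addr_small _ _ (g (u0 - L x0 + y))) => t t0.
    have tV0 : 0 < t^-1 by rewrite invr_gt0.
    have : (-%R @` S) (- (t^-1 *: s)) by exists (t^-1 *: s) => //; exact: S_cone.
    move=> /mono; case Pu : (Phi (x0, _)) => [u| |] //=; last by case: (Phi_Ny Pu).
    move=> -[c Kc cE]; have := fg _ _ _ Pu.
    have -> : u0 - L x0 + y = (u - L x0 + y) + c.
      by rewrite -[c]opprK cE opprB [RHS]addrC !addrA subrK.
    rewrite linearN linearZ => h; rewrite linearD.
    have -> : - f s + t * (g (u - L x0 + y) + g c) =
        t * (- (t^-1 * f s) + g (u - L x0 + y)) + t * g c.
      by field; exact: lt0r_neq0.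
    by rewrite addr_ge0 // mulr_ge0 ?(ltW t0) //; exact: g_ge0.
  rewrite TE; have : 0 <= - f s / g k0 by rewrite divr_ge0 ?oppr_ge0 // ltW.
  (* A zero coefficient is covered by [K0], since cones give positive multiples only. *)
  rewrite le_eqVlt => /predU1P[<-|c0]; first by rewrite scale0r.
  have [_] := K_cone; apply => //; exact: interior_subset.
Qed.

End Perturbation.

(** * Equivalence of the primal and dual assertions *)

Theorem theorem3p5 (R : realType) (X Y Z : tvsType R)
  (hX : hausdorff_space X) (hY : hausdorff_space Y) (hZ : hausdorff_space Z)
  (K : set Y) (K_proper : K <> setT) (K_closed : closed K)
  (K_cone : convex_cone K) (K_int : K° !=set0)
  (S : set Z) (S_neq0 : S !=set0) (S_cone : convex_cone S)
  (Phi : X * Z -> \bar Y) (Phi_Ny : forall p, Phi p <> -oo%E)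
  (Phi_convex : Kconvex K Phi)
  (Phi_dom : (snd @` dom Phi) 0)
  (regularity : forall L : {linear X -> Y}, continuous L ->
    exists (yL : Y) (VL : set Z), nbhs 0 VL /\
      forall z, (VL `&` lin (snd @` dom Phi)) z ->
        exists x : X, leK K (Phi (x, z) - (L x)%:E)%E yL%:E) :
  (forall (L : {linear X -> Y}) (y : Y), continuous L ->
    (forall x, ~ Nint K (Phi (x, 0%R) - (L x)%:E + y%:E)%E)
    <->
    (exists2 T : {linear Z -> Y}, LPhi K Phi T &
      forall x z, ~ Nint K (Phi (x, z) - (L x)%:E - (T z)%:E + y%:E)%E))
  /\
  ((exists2 x0 : X, dom Phi (x0, 0) &
      forall z, (-%R @` S) z -> leK K (Phi (x0, z)) (Phi (x0, 0))) ->
   forall (L : {linear X -> Y}) (y : Y), continuous L ->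
    (forall x, ~ Nint K (Phi (x, 0%R) - (L x)%:E + y%:E)%E)
    <->
    (exists2 T : {linear Z -> Y}, LPhi_plus S K Phi T &
      forall x z, ~ Nint K (Phi (x, z) - (L x)%:E - (T z)%:E + y%:E)%E)).
Proof.
have [K_convex K_conic] := K_cone; have [S_convex S_conic] := S_cone.
have K0 : K 0.
  apply: closed_cone0 => //; have [k Kk] := K_int.
  by exists k; exact: interior_subset.
(* The way back to (alpha) is the case [z = 0], where [T] vanishes. *)
have direct L (T : {linear Z -> Y}) y :
    (forall x z, ~ Nint K (Phi (x, z) - (L x)%:E - (T z)%:E + y%:E)%E) ->
    forall x : X, ~ Nint K (Phi (x, 0%R) - (L x)%:E + y%:E)%E.
  move=> hT x; have := hT x 0; rewrite linear0.
  case: (Phi _) => [u| |] // nK [k Kk kE]; apply: nK; exists k => //.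
  by rewrite kE; congr EFin; rewrite subr0.
have multiplier (L : {linear X -> Y}) y : continuous L ->
    (forall x, ~ Nint K (Phi (x, 0%R) - (L x)%:E + y%:E)%E) ->
    exists T : {linear Z -> Y}, [/\ LPhi K Phi T,
        forall x z, ~ Nint K (Phi (x, z) - (L x)%:E - (T z)%:E + y%:E)%E &
        (exists2 x0, dom Phi (x0, 0) &
           forall z, (-%R @` S) z -> leK K (Phi (x0, z)) (Phi (x0, 0))) ->
        T @` S `<=` K].
  move=> cL alpha; have [yL [V [V0 V_bound]]] := regularity L cL.
  have [T [cT hT TS]] := vector_multiplier Phi_Ny K_cone K0 K_int Phi_convex
    S_conic V0 V_bound alpha.
  (* The given [L] itself witnesses that [T] belongs to [LPhi]. *)
  exists T; split=> //; split=> //; exists L => //.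
  exact: conjugate_neq_pinfty hT.
split=> [|mono] L y cL; split=> [/(multiplier _ _ cL)[T [TPhi hT TS]]|[T _ /direct//]].
  by exists T.
by exists T => //; split=> //; split; [case: TPhi|exact: TS].
Qed.
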